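(* Let $X$ be a closed subset of $\mathbb{R}^n$, let $p\in\mathbb{N}$, and let $f:X\to\mathbb{R}$. If $f$ is the restriction to $X$ of a function of class $\mathcal{C}^p$ on $\mathbb{R}^n$, then $\nabla^p f:\tau^p(X)\to\mathbb{R}$ (i.e. $\nabla^p f$ is the graph of a function on $\tau^p(X)$). Moreover, if $F\in\mathcal{C}^p(\mathbb{R}^n)$ and $F|X=f$, then for all $a\in X$ and all $\xi\in\tau^p_a(X)\subset\mathcal{P}_p^*$, $$\nabla^p f(\xi)=\xi(T^p_aF),$$ where $T^p_aF$ is the Taylor polynomial of order $p$ of $F$ at $a$.
   Context: Notation. $\mathbb{N}$ denotes the nonnegative integers; multiindex notation $\alpha\in\mathbb{N}^n$, $|\alpha|=\alpha_1+\dots+\alpha_n$, $\alpha!=\alpha_1!\cdots\alpha_n!$, $x^\alpha=x_1^{\alpha_1}\cdots x_n^{\alpha_n}$. $\mathcal{P}_p=\mathcal{P}_p(\mathbb{R}^n)$ is the real vector space of polynomial functions on $\mathbb{R}^n$ of degree at most $p$, $\mathcal{P}_p^*$ its dual, and $r=\dim\mathcal{P}_p$. For $\xi\in\mathcal{P}_p^*$, $b\in\mathbb{R}^n$ and $|\alpha|\le p$ put $\xi_\alpha(b):=\xi\big(\tfrac{1}{\alpha!}(x-b)^\alpha\big)$. For $a\in\mathbb{R}^n$, $\delta_a\in\mathcal{P}_p^*$ is $\delta_a(P)=P(a)$. A bundle over $X$ with fibres in a finite-dimensional real vector space $W$ is a subset $E\subset X\times W$ such that each fibre $E_a=\{w:(a,w)\in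 E\}$ is a linear subspace of $W$. Paratangent bundle of order $p$. For a bundle $E\subset X\times\mathcal{P}_p^*$ let $\Delta E=\{(a,b,\xi+\eta): a,b\in X,\ \xi\in E_a,\ \eta\in E_b,\ |a-b|^{p-|\alpha|}|\eta_\alpha(b)|\le 1\text{ for all }|\alpha|\le p\}$, let $E'=\{(a,\xi)\in X\times\mathcal{P}_p^*: (a,a,\xi)\in\overline{\Delta E}\}$ (closure in $X\times X\times\mathcal{P}_p^*$), and let $\rho(E)=\{(a,\xi):a\in X,\ \xi\in\operatorname{Span}E'_a\}$. Let $E_0=\{(a,\lambda\delta_a):a\in X,\lambda\in\mathbb{R}\}$. The bundles $\rho^i(E_0)$ coincide for all $i\ge 2r$, and $\tau^p(X):=\rho^{2r}(E_0)$, with fibres $\tau^p_a(X)\subset\mathcal{P}_p^*$. The bundle $\nabla^p f$. For a bundle $\Phi\subset X\times(\mathcal{P}_p^*\times\mathbb{R})$ let $\Delta\Phi=\{(a,b,\xi+\eta,\lambda+\mu): a,b\in X,\ (\xi,\lambda)\in\Phi_a,\ (\eta,\mu)\in\Phi_b,\ |a-b|^{p-|\alpha|}|\eta_\alpha(b)|\le1\text{ for all }|\alpha|\le p\}$, $\Phi'=\{(a,\xi,\lambda):(a,a,\xi,\lambda)\in\overline{\Delta\Phi}\}$, and $\rho(\Phi)=\{(a,v): v\in\operatorname{Span}\Phi'_a\}$. Let $\Phi_0=\{(a,\lambda\delta_a,\lambda f(a)):a\in X,\lambda\in\mathbb{R}\}$; the bundles $\rho^i(\Phi_0)$ coincide for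 $i\ge 2(r+1)$ and $\nabla^pf:=\rho^{2(r+1)}(\Phi_0)$. One has $\nabla^pf\subset\tau^p(X)\times\mathbb{R}$. ''$\nabla^pf:\tau^p(X)\to\mathbb{R}$'' means that for each $a\in X$ and $\xi\in\tau^p_a(X)$ there is exactly one $\lambda$ with $(a,\xi,\lambda)\in\nabla^pf$; this $\lambda$ is denoted $\nabla^pf(\xi)$. *)

(* Defs.v *)
From HB Require Import structures.
From mathcomp Require Import all_boot all_order all_algebra.
From mathcomp Require Import all_classical all_reals all_analysis.
Set Implicit Arguments. Unset Strict Implicit. Unset Printing Implicit Defensive.
Import Order.TTheory GRing.Theory Num.Theory.
Import numFieldNormedType.Exports.
Local Open Scope classical_set_scope.
Local Open Scope ring_scope.

Section Defs.
Variables (R : realType) (n p : nat).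

Notation pt := 'rV[R]_n.

Definition mindex := {a : {ffun 'I_n -> 'I_p.+1} | (\sum_i (a i : nat) <= p)%N}.
Definition mi (a : mindex) (i : 'I_n) : nat := (sval a i : nat).
Definition mdeg (a : mindex) : nat := (\sum_i mi a i)%N.
Definition mfact (a : mindex) : nat := (\prod_i (mi a i)`!)%N.

Definition rdim : nat := #|{: mindex}|.

(* Both P_p and its dual P_p^* are represented by coordinate row vectors of
   length r indexed by the multiindices: a polynomial P by its coefficients
   in the monomial basis (x^alpha), and a functional xi by its values
   xi(x^alpha) on that basis. *)
Definition coord (v : 'rV[R]_rdim) (a : mindex) : R := v 0 (enum_rank a).

Definition pairing (xi P : 'rV[R]_rdim) : R := \sum_a coord P a * coord xi a.

Definition mono (x : pt) (a : mindex) : R := \prod_i x 0 i ^+ mi a i.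

Definition dirac_pt (a : pt) : 'rV[R]_rdim := \row_j mono a (enum_val j).

(* The polynomial (1/alpha!) (x-b)^alpha, in the monomial basis:
   coefficient of x^beta is (1/alpha!) prod_i C(alpha_i,beta_i) (-b_i)^(alpha_i-beta_i)
   if beta <= alpha componentwise, else 0. *)
Definition shiftmono (b : pt) (a : mindex) : 'rV[R]_rdim :=
  \row_j (let c := enum_val j in
          if [forall i, (mi c i <= mi a i)%N]
          then (mfact a)%:R^-1 *
               \prod_i ('C(mi a i, mi c i)%:R * (- b 0 i) ^+ (mi a i - mi c i))
          else 0).

Definition xi_at (xi : 'rV[R]_rdim) (a : mindex) (b : pt) : R :=
  pairing xi (shiftmono b a).

Definition enorm (x : pt) : R := Num.sqrt (\sum_i x 0 i ^+ 2).

Definition span_set (V : lmodType R) (S : set V) : set V :=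
  [set v | exists k (c : 'I_k -> R) (w : 'I_k -> V),
             (forall i, S (w i)) /\ v = \sum_i c i *: w i].

Variable X : set pt.

Definition DeltaE (E : set (pt * 'rV[R]_rdim)) : set ((pt * pt) * 'rV[R]_rdim) :=
  [set z | let: (a, b, zeta) := z in
     X a /\ X b /\ exists xi eta, E (a, xi) /\ E (b, eta) /\ zeta = xi + eta /\
       forall al : mindex, enorm (a - b) ^+ (p - mdeg al)%N * `|xi_at eta al b| <= 1].

Definition Eprime (E : set (pt * 'rV[R]_rdim)) : set (pt * 'rV[R]_rdim) :=
  [set z | X z.1 /\ closure (DeltaE E) (z.1, z.1, z.2)].

Definition rhoE (E : set (pt * 'rV[R]_rdim)) : set (pt * 'rV[R]_rdim) :=
  [set z | X z.1 /\ span_set [set xi | Eprime E (z.1, xi)] z.2].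

Definition E0 : set (pt * 'rV[R]_rdim) :=
  [set z | X z.1 /\ exists lam : R, z.2 = lam *: dirac_pt z.1].

Definition tau : set (pt * 'rV[R]_rdim) := iter (2 * rdim) rhoE E0.

Definition DeltaPhi (Phi : set (pt * ('rV[R]_rdim * R)))
  : set ((pt * pt) * ('rV[R]_rdim * R)) :=
  [set z | let: (a, b, w) := z in
     X a /\ X b /\ exists u v, Phi (a, u) /\ Phi (b, v) /\ w = u + v /\
       forall al : mindex, enorm (a - b) ^+ (p - mdeg al)%N * `|xi_at v.1 al b| <= 1].

Definition Phiprime (Phi : set (pt * ('rV[R]_rdim * R))) : set (pt * ('rV[R]_rdim * R)) :=
  [set z | X z.1 /\ closure (DeltaPhi Phi) (z.1, z.1, z.2)].

Definition rhoPhi (Phi : set (pt * ('rV[R]_rdim * R))) : set (pt * ('rV[R]_rdim * R)) :=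
  [set z | X z.1 /\ span_set [set u | Phiprime Phi (z.1, u)] z.2].

Definition Phi0 (f : pt -> R) : set (pt * ('rV[R]_rdim * R)) :=
  [set z | X z.1 /\ exists lam : R, z.2 = (lam *: dirac_pt z.1, lam * f z.1)].

Definition nabla (f : pt -> R) : set (pt * ('rV[R]_rdim * R)) :=
  iter (2 * rdim.+1) rhoPhi (Phi0 f).

End Defs.

Section Diff.
Variables (R : realType) (n : nat).
Notation pt := 'rV[R]_n.

Definition dpart (F : pt -> R) (i : 'I_n) : pt -> R :=
  fun x => 'D_(delta_mx 0 i) F x.

Definition diter (F : pt -> R) (s : seq 'I_n) : pt -> R :=
  foldr (fun i g => dpart g i) F s.

Definition Cp (p : nat) (F : pt -> R) : Prop :=
  (forall s : seq 'I_n, (size s < p)%N ->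
     forall (x : pt) (i : 'I_n), derivable (diter F s) x (delta_mx 0 i)) /\
  (forall s : seq 'I_n, (size s <= p)%N -> continuous (diter F s)).

Definition dmulti (p : nat) (F : pt -> R) (a : mindex n p) : pt -> R :=
  diter F (flatten [seq nseq (mi a i) i | i <- enum 'I_n]).

Definition taylor (p : nat) (F : pt -> R) (a : pt) : 'rV[R]_(rdim n p) :=
  \sum_(al : mindex n p) dmulti F al a *: shiftmono a al.

End Diff.

Arguments tau {R n} p X _.
Arguments nabla {R n} p X f _.
Arguments pairing {R n} p xi P.

(* Main.v *)
Require Import Defs.
From HB Require Import structures.
From mathcomp Require Import all_boot all_order all_algebra.
From mathcomp Require Import all_classical all_reals all_analysis.
From mathcomp Require Import ring lra.
Set Implicit Arguments. Unset Strict Implicit. Unset Printing Implicit Defensive.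
Import Order.TTheory GRing.Theory Num.Theory.
Import numFieldNormedType.Exports.
Local Open Scope classical_set_scope.
Local Open Scope ring_scope.

(* If a bundle Phi is the graph of xi |-> xi(T_a^p F) over a bundle E, then rho(Phi) is
   the graph of the same map over rho(E). Indeed, for xi in E_a and eta in E_b,

     xi(T_a F) + eta(T_b F) = (xi + eta)(T_a F) + sum_beta eta_beta(b) r_beta(a,b),

   where r_beta(a,b) = D^beta F(b) - D^beta(T_a F)(b), and r_beta(a,b) is
   o(|a-b|^(p-|beta|)) as a and b tend to a common point, so that the bounds on eta in
   the definition of Delta make the error term disappear in the limit. Spans preserve
   graphs because the map is linear on each fibre. As delta_a(T_a F) = F(a), all the
   iterates of Phi_0 are therefore graphs over the iterates of E_0.

   The estimate on r_beta goes by descending induction on |beta|: r_beta(a,.) vanishes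
   at a and its i-th partial derivative is r_(beta+e_i)(a,.), by the symmetry of mixed
   partial derivatives; the mean value theorem is applied along the coordinate axes. *)

(** * Divided powers $t^A/A!$ in one variable *)

Section DividedPowers.
Variable R : realType.

(* The B-th derivative of t^A/A!. It vanishes for B > A, so sums over B need no
   side condition. *)
Definition dpow (A B : nat) (t : R) : R :=
  if (B <= A)%N then t ^+ (A - B) / (A - B)`!%:R else 0.

Lemma dpow0 A B : dpow A B 0 = (A == B)%:R.
Proof.
rewrite /dpow; case: ltngtP => [BA|AB|->]; last by rewrite subnn expr0 fact0 invr1 mulr1.
  by rewrite expr0n subn_eq0 leqNgt BA mul0r.
by [].
Qed.

(** The binomial theorem in divided form. Only the terms with $C\le B\le A$ are nonzero; the sum
    runs up to [p] to match the range of a multiindex entry. *)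
Lemma dpowD p A C (x y : R) : (A <= p)%N ->
  dpow A C (x + y) = \sum_(B < p.+1) dpow A B x * dpow B C y.
Proof.
move=> Ap; rewrite {1}/dpow; case: leqP => [CA|AC]; last first.
  rewrite big1 // => B _; rewrite /dpow; case: leqP => [BA|_]; last by rewrite mul0r.
  by rewrite [(C <= B)%N]leqNgt (leq_ltn_trans BA AC) mulr0.
rewrite -(big_mkord xpredT (fun B => dpow A B x * dpow B C y)).
rewrite (@big_cat_nat _ _ _ C) ?leqW ?(leq_trans CA) //=.
rewrite [X in _ = X + _]big_nat_cond big1 ?add0r; last first.
  by move=> B; rewrite andbT => /andP[_ BC]; rewrite /dpow [(C <= B)%N]leqNgt BC mulr0.
rewrite (@big_cat_nat _ _ _ A.+1) ?(leqW CA) //=.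
rewrite [X in _ = _ + X]big_nat_cond [X in _ = _ + X]big1 ?addr0; last first.
  by move=> B; rewrite andbT => /andP[AB _]; rewrite /dpow leqNgt AB mul0r.
have := @big_addn _ 0 +%R 0 A.+1 C xpredT (fun B => dpow A B x * dpow B C y).
rewrite add0n subSn // => ->; rewrite big_mkord exprDn mulr_suml.
apply: eq_bigr => -[i /=]; rewrite ltnS => iAC _.
have iCA : (i + C <= A)%N by rewrite addnC -leq_subRL.
rewrite /dpow iCA leq_addl addnK addnC subnDA -mulr_natr.
set m := (A - C)%N in iAC *.
rewrite -(bin_fact iAC) !natrM.
have f k : (k`!%:R : R) != 0 by rewrite pnatr_eq0 -lt0n fact_gt0.
have fb : 'C(m, i)%:R != 0 :> R by rewrite pnatr_eq0 -lt0n bin_gt0.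
by field; rewrite fb !f.

Qed.

Lemma is_derive_dpow A B (t : R) : is_derive t 1 (dpow A B) (dpow A B.+1 t).
Proof.
rewrite /dpow; case: (leqP B A) => [BA|AB]; last first.
  by rewrite ltnNge (ltnW AB) /=; exact: is_derive_cst.
have [m Am] : exists m, (A - B)%N = m by exists (A - B)%N.
rewrite -subn_gt0 subnS Am.
apply: is_derive_eq.
  have -> : (fun t : R => t ^+ m / m`!%:R) = (m`!%:R)^-1 \*: (@id R ^+ m).
    by apply/funext => z /=; rewrite mulrC exprfctE.
  exact: is_deriveZ.
rewrite /= scaler1 /GRing.scale/=.
case: m {Am} => [|m] /=; first by rewrite mul0r mulr0.
have fm : (m`!%:R : R) != 0 by rewrite pnatr_eq0 -lt0n fact_gt0.
have m1 : (m.+1%:R : R) != 0 by rewrite pnatr_eq0.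
by rewrite factS natrM; move: m.+1%:R m1 => c m1; field; rewrite fm m1.
Qed.

Lemma continuous_dpow A B : continuous (dpow A B : R -> R).
Proof.
move=> t; have [d _] := is_derive_dpow A B t.
exact/differentiable_continuous/derivable1_diffP.
Qed.

End DividedPowers.

(** * Multivariate Taylor expansion of polynomials and the pairing with $\mathcal{P}_p^*$ *)

Section Multiindices.
Variables (R : realType) (n p : nat).
Notation pt := 'rV[R]_n.
Notation mindex := (mindex n p).
Implicit Types (al be : mindex) (g : 'I_n -> nat) (x y : pt).

(* The g-th partial derivative of x^h/h!. *)
Definition wmono (g h : 'I_n -> nat) (x : pt) : R := \prod_i dpow (h i) (g i) (x 0 i).

Lemma mi_le al i : (mi al i <= p)%N.
Proof. by rewrite -ltnS; exact: ltn_ord. Qed.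

Lemma mdeg_le al : (mdeg al <= p)%N.
Proof. exact: (svalP al). Qed.

Lemma mi_inj al be : mi al =1 mi be -> al = be.
Proof. by move=> e; apply/val_inj/ffunP => i; apply/val_inj/e. Qed.

Lemma wmono_eq0 g h x i : (h i < g i)%N -> wmono g h x = 0.
Proof. by move=> hg; rewrite /wmono (bigD1 i) //= /dpow leqNgt hg mul0r. Qed.

Lemma wmono0 g h : wmono g h 0 = [forall i, h i == g i]%:R.
Proof.
rewrite /wmono; case: (boolP [forall i, h i == g i]) => [/forallP e|].
  by rewrite big1 // => i _; rewrite mxE dpow0 e.
by rewrite negb_forall => /existsP[i e]; rewrite (bigD1 i) //= mxE dpow0 (negPf e) mul0r.
Qed.

Lemma wmono_same g x : wmono g g x = 1.
Proof. by rewrite /wmono big1 // => i _; rewrite /dpow leqnn subnn expr0 fact0 divr1. Qed.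

Lemma wmonoD al g x y :
  wmono g (mi al) (x + y) = \sum_(be : mindex) wmono (mi be) (mi al) x * wmono g (mi be) y.
Proof.
rewrite /wmono.
under eq_bigr do rewrite mxE (dpowD _ _ _ (mi_le al _)).
rewrite bigA_distr_bigA /=.
(* Distributing the product gives a sum over all exponent functions. One of degree above [p] exceeds
   [al] in some coordinate, as $|al|\le p$, so its term is zero. *)
rewrite (bigID (fun b : {ffun 'I_n -> 'I_p.+1} => (\sum_i (b i : nat) <= p)%N)) /=.
rewrite [X in _ + X]big1 ?addr0; last first.
  move=> b bp; apply/eqP/prodf_eq0.
  have [i bi] : exists i, (mi al i < b i)%N.
    apply/existsP; rewrite -[X in is_true X]negbK negb_exists; apply: contra bp => /forallP bal.
    apply: leq_trans (mdeg_le al); apply: leq_sum => i _.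
    by rewrite leqNgt; exact: bal.
  by exists i => //; rewrite /dpow leqNgt bi mul0r.
rewrite (@big_sub _ _ _ _ [pred b : {ffun 'I_n -> 'I_p.+1} | (\sum_i (b i : nat) <= p)%N]) /=.
by apply: eq_bigr => be _; rewrite big_split.
Qed.

Lemma mfactE al : (mfact al)%:R = \prod_i (mi al i)`!%:R :> R.
Proof. by rewrite /mfact natr_prod. Qed.

(** The coefficient of $y^{be}$ is the [be]-th derivative at 0 of $(y-x)^{al}/al!$, divided by
    $be!$. *)
Lemma coord_shiftmono x al be :
  Defs.coord (shiftmono x al) be = wmono (mi be) (mi al) (- x) / (mfact be)%:R.
Proof.
rewrite /Defs.coord mxE enum_rankK /=.
case: (boolP [forall i, _]) => [/forallP ba|]; last first.
  rewrite negb_forall => /existsP[i]; rewrite -ltnNge => abi.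
  by rewrite (wmono_eq0 _ abi) mul0r.
rewrite !mfactE -!prodfV -!big_split /=; apply: eq_bigr => i _.
rewrite /dpow ba mxE -(bin_fact (ba i)) !natrM.
have f k : (k`!%:R : R) != 0 by rewrite pnatr_eq0 -lt0n fact_gt0.
have fb : 'C(mi al i, mi be i)%:R != 0 :> R by rewrite pnatr_eq0 -lt0n bin_gt0.
by field; rewrite fb !f.
Qed.

(** Taylor expansion about [b] of the monomial centred at [a]; on coefficients it is [wmonoD] for
    $-a=(b-a)+(-b)$. *)
Lemma shiftmono_rebase (a b : pt) al :
  shiftmono a al = \sum_(be : mindex) wmono (mi be) (mi al) (b - a) *: shiftmono b be.
Proof.
apply/rowP => k; rewrite -[k]enum_valK; set c := enum_val k.
rewrite summxE -/(Defs.coord _ c) coord_shiftmono.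
have -> : wmono (mi c) (mi al) (- a) = wmono (mi c) (mi al) ((b - a) - b).
  by rewrite addrAC subrr add0r.
rewrite wmonoD mulr_suml; apply: eq_bigr => be _.
by rewrite mxE -/(Defs.coord _ c) coord_shiftmono mulrA.
Qed.

Lemma pairing_sumr (I : finType) (c : I -> R) (P : I -> 'rV[R]_(rdim n p)) xi :
  pairing p xi (\sum_i c i *: P i) = \sum_i c i * pairing p xi (P i).
Proof.
rewrite /pairing; under eq_bigr do rewrite /Defs.coord summxE mulr_suml.
rewrite exchange_big; apply: eq_bigr => i _; rewrite mulr_sumr.
by apply: eq_bigr => be _; rewrite mxE mulrA.
Qed.

Lemma pairing_suml (I : finType) (c : I -> R) (xi : I -> 'rV[R]_(rdim n p)) P :
  pairing p (\sum_i c i *: xi i) P = \sum_i c i * pairing p (xi i) P.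
Proof.
rewrite /pairing; under eq_bigr do rewrite /Defs.coord summxE mulr_sumr.
rewrite exchange_big; apply: eq_bigr => i _; rewrite mulr_sumr.
by apply: eq_bigr => be _; rewrite mxE mulrCA.
Qed.

Lemma pairingDl xi eta (P : 'rV[R]_(rdim n p)) :
  pairing p (xi + eta) P = pairing p xi P + pairing p eta P.
Proof.
by rewrite /pairing -big_split; apply: eq_bigr => be _; rewrite /Defs.coord mxE mulrDr.
Qed.

Lemma pairingZl c xi (P : 'rV[R]_(rdim n p)) : pairing p (c *: xi) P = c * pairing p xi P.
Proof.
by rewrite /pairing mulr_sumr; apply: eq_bigr => be _; rewrite /Defs.coord mxE mulrCA.
Qed.

Lemma xi_at_dirac (x b : pt) al : xi_at (dirac_pt p x) al b = wmono (fun=> 0) (mi al) (x - b).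
Proof.
rewrite addrC wmonoD; apply: eq_bigr => be _.
rewrite coord_shiftmono /Defs.coord mxE enum_rankK -mulrA; congr (_ * _).
rewrite /wmono mfactE -prodfV -big_split; apply: eq_bigr => i _.
by rewrite /dpow leq0n subn0 mulrC.
Qed.

Lemma pairing_taylor (F : pt -> R) eta (b : pt) :
  pairing p eta (taylor p F b) = \sum_(al : mindex) dmulti F al b * xi_at eta al b.
Proof. exact: pairing_sumr. Qed.

(** Recentring at [b] brings in the numbers $\eta_\beta(b)$, the ones bounded in the definition of
    $\Delta$. The inner sum is $D^\beta(T_aF)(b)$. *)
Lemma pairing_taylor_rebase (F : pt -> R) eta (a b : pt) :
  pairing p eta (taylor p F a) = \sum_(be : mindex)
    (\sum_(al : mindex) dmulti F al a * wmono (mi be) (mi al) (b - a)) * xi_at eta be b.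
Proof.
rewrite pairing_taylor.
under eq_bigr => al _ do rewrite /xi_at (shiftmono_rebase a b) pairing_sumr mulr_sumr.
rewrite exchange_big; apply: eq_bigr => be _; rewrite mulr_suml.
by apply: eq_bigr => al _; rewrite mulrA.
Qed.

End Multiindices.

(** * Mean value theorem along a line and symmetry of second directional derivatives *)

Section DirectionalDerivatives.
Variable R : realType.

(** A directional derivative depends only on the increments along the line. This serves for
    translations, restrictions to a line and freezing of coordinates. *)
Lemma eq_is_derive (V V' : normedModType R) (f : V -> R) (g : V' -> R) a v a' v' :
  (forall h : R, f (h *: v + a) - f a = g (h *: v' + a') - g a') ->
  derivable f a v -> is_derive a' v' g ('D_v f a).
Proof.
move=> fg df.
have e : (fun h : R => h^-1 *: ((g \o shift a') (h *: v') - g a')) =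
         (fun h : R => h^-1 *: ((f \o shift a) (h *: v) - f a)).
  by apply/funext => h /=; rewrite fg.
by apply: DeriveDef; rewrite ?/derivable ?/derive e.
Qed.

Variable V : normedModType R.
Implicit Types (G : V -> R) (x y v w : V).

Lemma is_derive_shift G y c v : derivable G (y + c) v ->
  is_derive y v (fun z => G (z + c)) ('D_v G (y + c)).
Proof. by apply: eq_is_derive => h; rewrite addrA. Qed.

Lemma MVT_line G x v (h : R) : (forall y, derivable G y v) ->
  exists2 t, `|t| <= `|h| & G (x + h *: v) - G x = h * 'D_v G (x + t *: v).
Proof.
move=> dG; pose g t := G (x + t *: v).
have dg (t : R) : is_derive t 1 g ('D_v G (x + t *: v)).
  apply: eq_is_derive (dG _) => k; rewrite /g.
  by rewrite [k%:A]mulr1 scalerDl addrCA.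
have cg (a b : R) : {within `[a, b], continuous g}.
  by apply: derivable_within_continuous => t _; case: (dg t).
case: (leP 0 h) => [h0|/ltW h0].
  have [t] := MVT_segment h0 (fun t _ => dg t) (cg 0 h).
  rewrite in_itv /= => /andP[t0 th]; rewrite /g scale0r addr0 subr0 mulrC => e.
  by exists t => //; rewrite !ger0_norm.
(* For $h\le 0$ the segment is $[h,0]$ and both sides change sign. *)
have [t] := MVT_segment h0 (fun t _ => dg t) (cg h 0).
rewrite in_itv /= => /andP[th t0]; rewrite /g scale0r addr0 sub0r mulrN => e.
exists t; first by rewrite !ler0_norm // lerN2.
by rewrite -opprB e opprK mulrC.
Qed.

(** The mean value theorem is applied along [v] to $y\mapsto G(y+hw)-G(y)$, then along [w] to the
    derivative of [G] in direction [v]. *)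
Lemma second_difference G x v w (h : R) :
  (forall y, derivable G y v) -> (forall y, derivable ('D_v G) y w) ->
  exists t s, [/\ `|t| <= `|h|, `|s| <= `|h| &
    G (x + h *: v + h *: w) - G (x + h *: v) - (G (x + h *: w) - G x) =
    h * (h * 'D_w ('D_v G) (x + t *: v + s *: w))].
Proof.
move=> dG ddG; pose g y := G (y + h *: w) - G y.
have dg y : is_derive y v g ('D_v G (y + h *: w) - 'D_v G y).
  by apply: is_deriveB; [exact: is_derive_shift|exact: derivableP].
have [t th e] := @MVT_line g x v h (fun y => @ex_derive _ _ _ _ _ _ _ (dg y)).
have [s sh e'] := @MVT_line ('D_v G) (x + t *: v) w h ddG.
exists t, s; split => //; rewrite -e' -/(g _) -/(g _) e.
by congr (_ * _); rewrite (@derive_val _ _ _ _ _ _ _ (dg _)).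
Qed.

Lemma eq_of_close_values (A B : V -> R) x : {for x, continuous A} -> {for x, continuous B} ->
  (forall d : R, 0 < d -> exists y z, [/\ ball x d y, ball x d z & A y = B z]) -> A x = B x.
Proof.
move=> cA cB H.
apply/eqP; rewrite -subr_eq0 -normr_le0; apply/ler_addgt0Pr => e e0; rewrite add0r.
have e2 : 0 < e / 2 by rewrite divr_gt0.
have /cvgrPdist_lt/(_ _ e2)/nbhs_ballP[d1 /= d10 H1] := cA.
have /cvgrPdist_lt/(_ _ e2)/nbhs_ballP[d2 /= d20 H2] := cB.
have m0 : 0 < Num.min d1 d2 by rewrite lt_min d10.
have m1 : Num.min d1 d2 <= d1 by rewrite ge_min lexx.
have m2 : Num.min d1 d2 <= d2 by rewrite ge_min lexx orbT.
have [y [z [xy xz yz]]] := H _ m0.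
have := H1 _ (le_ball m1 xy); have := H2 _ (le_ball m2 xz).
rewrite /= -yz distrC => k2 k1.
rewrite [leRHS]splitr; apply: le_trans _ (ltW (ltrD k1 k2)).
by rewrite (le_trans _ (ler_normD _ _)) // addrA subrK.
Qed.

(** The second difference is symmetric in [v] and [w], so the two mixed derivatives take a common
    value at two points near [x]; continuity concludes. *)
Lemma schwarz G v w :
  (forall y, derivable G y v) -> (forall y, derivable G y w) ->
  (forall y, derivable ('D_v G) y w) -> (forall y, derivable ('D_w G) y v) ->
  continuous ('D_w ('D_v G)) -> continuous ('D_v ('D_w G)) ->
  'D_w ('D_v G) = 'D_v ('D_w G).
Proof.
move=> dv dw dvw dwv cvw cwv; apply/funext => x.
apply: eq_of_close_values (cvw x) (cwv x) _ => d d0.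
(* This makes $|h|(|v|+|w|)<d$; the added 1 keeps the denominator positive. *)
pose h := d / (`|v| + `|w| + 1).
have N0 : 0 < `|v| + `|w| + 1 by rewrite ltr_wpDl // addr_ge0.
have h0 : 0 < h by rewrite divr_gt0.
have small t s v' w' : `|t| <= `|h| -> `|s| <= `|h| -> `|v'| + `|w'| = `|v| + `|w| ->
    ball x d (x + t *: v' + s *: w').
  move=> th sh e'; rewrite -ball_normE /= -addrA opprD addrA subrr sub0r normrN.
  apply: le_lt_trans (ler_normD _ _) _; rewrite !normrZ.
  apply: (@le_lt_trans _ _ (`|h| * (`|v'| + `|w'|))).
    by rewrite mulrDr lerD // ler_wpM2r.
  rewrite e' gtr0_norm // /h mulrAC -mulrA gtr_pMr //.
  by rewrite ltr_pdivrMr // mul1r ltrDl.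
have [t [s [th sh e1]]] := second_difference x h dv dvw.
have [t' [s' [th' sh' e1']]] := second_difference x h dw dwv.
exists (x + t *: v + s *: w), (x + t' *: w + s' *: v); split.
- exact: small.
- by apply: small => //; exact: addrC.
have h_neq0 : h != 0 by rewrite gt_eqF.
move: ('D_w _ _) ('D_v _ _) e1 e1' => A B e1 e1'.
apply/(mulfI h_neq0)/(mulfI h_neq0); rewrite -e1 -e1' [x + h *: v + _]addrAC.
by ring.
Qed.

End DirectionalDerivatives.

(** * Partial derivatives: increments, order of differentiation, monomials *)

Section CoordinateDerivatives.
Variables (R : realType) (n : nat).
Notation pt := 'rV[R]_n.
Implicit Types (a b x y : pt) (F G : pt -> R) (g h : 'I_n -> nat).
Local Notation e_ i := (delta_mx 0 i : pt).

Lemma coord_le_norm x i : `|x 0 i| <= `|x|.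
Proof.
rewrite [leRHS]mx_normrE.
exact: (le_bigmax _ (fun ij : 'I_1 * 'I_n => `|x ij.1 ij.2|) (0, i)).
Qed.

Lemma rV_norm_le x (d : R) : 0 <= d -> (forall i, `|x 0 i| <= d) -> `|x| <= d.
Proof.
move=> d0 xd; rewrite [leLHS]mx_normrE; apply: bigmax_le => // -[i j] _ /=.
by rewrite ord1.
Qed.

(** Compares the maximum norm, used for all estimates, with the Euclidean norm in the weights of
    $\Delta$. *)
Lemma norm_le_enorm x : `|x| <= enorm x.
Proof.
apply: rV_norm_le => [|i]; first exact: sqrtr_ge0.
rewrite -sqrtr_sqr ler_wsqrtr // (bigD1 i) //= lerDl.
by apply: sumr_ge0 => j _; exact: sqr_ge0.
Qed.

Lemma increment_le G (K d : R) a b :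
  (forall y i, derivable G y (e_ i)) ->
  (forall y i, `|y - a| <= d -> `|'D_(e_ i) G y| <= K) ->
  `|b - a| <= d -> `|G b - G a| <= n%:R * (K * d).
Proof.
move=> dG KG bad.
have d0 : 0 <= d := le_trans (normr_ge0 _) bad.
(* A path from [a] to [b] changing one coordinate at a time; in the maximum norm it stays within [d]
   of [a]. *)
pose z k : pt := \row_j if (j < k)%N then b 0 j else a 0 j.
have -> : G b - G a = \sum_(0 <= k < n) (G (z k.+1) - G (z k)).
  rewrite telescope_sumr //; congr (G _ - G _); apply/rowP => j; rewrite mxE //.
  by rewrite ltn_ord.
rewrite big_mkord; apply: le_trans (ler_norm_sum _ _ _) _.
rewrite mulr_natl -[X in _ *+ X]card_ord -sumr_const; apply: ler_sum => k _.
have -> : z k.+1 = z k + (b 0 k - a 0 k) *: e_ k.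
  apply/rowP => j; rewrite !mxE eqxx /= ltnS leq_eqVlt -(inj_eq val_inj) /=.
  case: eqVneq => [/val_inj ->|_]; last by rewrite mulr0 addr0.
  by rewrite ltnn mulr1 addrC subrK.
have hd i : `|b 0 i - a 0 i| <= d.
  by apply: le_trans bad; have := coord_le_norm (b - a) i; rewrite !mxE.
have [t th ->] := @MVT_line _ _ G (z k) (e_ k) (b 0 k - a 0 k) (fun y => dG y k).
rewrite normrM mulrC; apply: ler_pM => //; apply: KG.
apply: rV_norm_le => // j; rewrite !mxE eqxx /=.
case: (eqVneq j k) => [->|jk].
  by rewrite ltnn mulr1 addrAC subrr add0r (le_trans th).
by rewrite mulr0 addr0; case: ifP => // _; rewrite subrr normr0.
Qed.

(* The order of differentiation used by dmulti, for arbitrary exponents. *)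
Definition mseq g : seq 'I_n := flatten [seq nseq (g i) i | i <- enum 'I_n].

Definition mincr g (i : 'I_n) : 'I_n -> nat := fun j => (g j + (j == i))%N.

Lemma count_mseq g j : count_mem j (mseq g) = g j.
Proof.
rewrite count_flatten -map_comp sumnE big_map big_enum /= (bigD1 j) //=.
rewrite count_nseq /= eqxx mul1n big1 ?addn0 // => i ij.
by rewrite count_nseq /= (negPf ij).
Qed.

Lemma size_mseq g : size (mseq g) = (\sum_i g i)%N.
Proof.
rewrite size_flatten /shape -map_comp sumnE big_map big_enum /=.
by apply: eq_bigr => i _; rewrite size_nseq.
Qed.

Lemma perm_mseq_incr g i : perm_eq (i :: mseq g) (mseq (mincr g i)).
Proof.
by apply/allP => j _; apply/eqP; rewrite /= !count_mseq /mincr addnC eq_sym.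
Qed.

Lemma sum_mincr g i : (\sum_j mincr g i j = (\sum_j g j).+1)%N.
Proof.
by rewrite -!size_mseq -(perm_size (perm_mseq_incr g i)).
Qed.

(** Induction on the length. If the first letters [i] and [j] differ, the tails are rearranged, by
    induction, to [j :: u] and [i :: u] with a common [u], and [schwarz] swaps the two outermost
    derivatives. *)
Lemma diter_perm p F s s' : Cp p F -> (size s <= p)%N -> perm_eq s s' ->
  diter F s = diter F s'.
Proof.
move=> [dF cF]; have [k] := ubnP (size s); elim: k s s' => // k IH [|i s] s'.
  by move=> _ _ /perm_size/esym/size0nil ->.
rewrite /= !ltnS => sk sp; case: s' => [/perm_size //|j s'] pss.
have ssz : size s' = size s by have /= [->] := perm_size pss.
have [ij|ij] := eqVneq i j.
  rewrite -ij in pss *; congr (dpart _ i); apply: IH => //; first exact: ltnW.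
  by rewrite perm_cons in pss.
have js : j \in s.
  by have := perm_mem pss j; rewrite !inE eqxx /= eq_sym (negPf ij).
pose u := rem j s.
have psu : perm_eq s (j :: u) := perm_to_rem js.
have su : size s = (size u).+1 by rewrite (perm_size psu).
have ps'u : perm_eq s' (i :: u).
  rewrite -(perm_cons j) -(permPl pss) perm_sym.
  rewrite (perm_catCA [:: j] [:: i] u) /= perm_cons perm_sym; exact: psu.
have -> : diter F s = diter F (j :: u) by apply: IH => //; exact: ltnW.
have e : diter F s' = diter F (i :: u) by apply: IH; rewrite ?ssz //; exact: ltnW.
rewrite -[diter F (j :: s')]/(dpart (diter F s') j) e.
rewrite su in sp.
apply: (@schwarz _ _ (diter F u) (e_ j) (e_ i)) => [y|y|y|y||].
- by apply: dF; exact: ltnW.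
- by apply: dF; exact: ltnW.
- exact: (dF (j :: u)).
- exact: (dF (i :: u)).
- exact: (cF [:: i, j & u]).
- exact: (cF [:: j, i & u]).
Qed.

Lemma is_derive_wmono g h a b i :
  is_derive b (e_ i) (fun y => wmono g h (y - a)) (wmono (mincr g i) h (b - a)).
Proof.
(* Along $e_i$ only the [i]-th factor varies; [c] collects the others. *)
pose c : R := \prod_(j | j != i) dpow (h j) (g j) ((b - a) 0 j).
pose f (t : R) := dpow (h i) (g i) t * c.
have df : is_derive ((b - a) 0 i) 1 f (wmono (mincr g i) h (b - a)).
  apply: is_derive_eq.
    have -> : f = c \*: dpow (h i) (g i) by apply/funext => t; rewrite /f mulrC.
    by apply: is_deriveZ; exact: is_derive_dpow.
  rewrite /wmono (bigD1 i) //= /mincr eqxx addn1 [LHS]mulrC; congr (_ * _).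
  by apply: eq_bigr => j /negPf ->; rewrite addn0.
rewrite -(@derive_val _ _ _ _ _ _ _ df); apply: eq_is_derive; last by case: df.
have E y : (forall j, j != i -> y 0 j = (b - a) 0 j) -> wmono g h y = f (y 0 i).
  move=> yj; rewrite /wmono (bigD1 i) //=; congr (_ * _).
  by apply: eq_bigr => j /yj ->.
move=> t; rewrite -[f ((b - a) 0 i)]E // [k in _ = k - _]E.
  by rewrite !mxE !eqxx [t%:A]mulr1 mulr1 addrA.
by move=> j /negPf ji; rewrite !mxE ji andbF mulr0 add0r.
Qed.

End CoordinateDerivatives.

(** * Uniform estimates for the Taylor remainder and its derivatives *)

Section TaylorRemainder.
Variables (R : realType) (n p : nat).
Notation pt := 'rV[R]_n.
Variable F : pt -> R.
Hypothesis CpF : Cp p F.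
Implicit Types (a b x y : pt) (g : 'I_n -> nat).
Local Notation e_ i := (delta_mx 0 i : pt).

(* D^g F(b) - D^g(T_a^p F)(b). *)
Definition taylor_rem a g b : R :=
  diter F (mseq g) b - \sum_(al : mindex n p) dmulti F al a * wmono g (mi al) (b - a).

Lemma is_derive_taylor_rem a g b i : (\sum_j g j < p)%N ->
  is_derive b (e_ i) (taylor_rem a g) (taylor_rem a (mincr g i) b).
Proof.
move=> gp; rewrite /taylor_rem; apply: is_deriveB.
  (* The new derivative comes outermost, which need not be its place in [mseq (mincr g i)]; symmetry
     of mixed partials moves it there. *)
  rewrite -(diter_perm CpF _ (perm_mseq_incr g i)) ?[size _]/= ?size_mseq //.
  by apply: derivableP; apply: CpF.1; rewrite size_mseq.
have -> : (fun x => \sum_(al : mindex n p) dmulti F al a * wmono g (mi al) (x - a)) =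
   \sum_(al : mindex n p) dmulti F al a \*: (fun x => wmono g (mi al) (x - a)).
  by apply/funext => x; rewrite fct_sumE.
elim/big_ind2 : _ => [|f1 d1 f2 d2 h1 h2|al _]; first exact: is_derive_cst.
  exact: is_deriveD.
by apply: is_deriveZ; exact: is_derive_wmono.
Qed.

Lemma mindex_of g : (\sum_j g j <= p)%N -> exists al : mindex n p, mi al =1 g.
Proof.
move=> gp.
have gip i : (g i < p.+1)%N by rewrite ltnS (leq_trans _ gp) // (bigD1 i) //= leq_addr.
have s : (\sum_i ([ffun i => Ordinal (gip i)] i : nat) <= p)%N.
  by under eq_bigr do rewrite ffunE.
pose P (c : {ffun 'I_n -> 'I_p.+1}) : bool := (\sum_i (c i : nat) <= p)%N.
by exists (exist P _ s) => i; rewrite /mi /= ffunE.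
Qed.

(** Common core of two cases where only the term of index [g] survives: $b=a$, and $|g|=p$. *)
Lemma taylor_sum_single a g b : (\sum_j g j <= p)%N ->
  (forall al : mindex n p, mi al =1 g \/ wmono g (mi al) (b - a) = 0) ->
  \sum_(al : mindex n p) dmulti F al a * wmono g (mi al) (b - a) = diter F (mseq g) a.
Proof.
move=> gp H; have [al alg] := mindex_of gp.
rewrite (bigD1 al) //= big1 => [|be beal]; last first.
  case: (H be) => [beg|->]; last by rewrite mulr0.
  by case/eqP: beal; apply: mi_inj => i; rewrite beg alg.
have -> : g = mi al by apply/funext => i; rewrite alg.
by rewrite wmono_same mulr1 addr0.
Qed.

Lemma taylor_rem_diag a g : (\sum_j g j <= p)%N -> taylor_rem a g a = 0.
Proof.
move=> gp; rewrite /taylor_rem taylor_sum_single ?subrr // => al.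
rewrite wmono0; case: (boolP [forall i, _]) => [/forallP e|_]; last by right.
by left => i; apply/eqP.
Qed.

Lemma taylor_rem_top a g b : (\sum_j g j)%N = p ->
  taylor_rem a g b = diter F (mseq g) b - diter F (mseq g) a.
Proof.
move=> gp; rewrite /taylor_rem taylor_sum_single ?gp // => al.
have [/existsP[i ig]|] := boolP [exists i, (mi al i < g i)%N].
  by right; rewrite (wmono_eq0 _ ig).
rewrite negb_exists => /forallP H; left.
(* Now $g\le al$ and $|al|\le p=|g|$, which forces equality. *)
have le i : (g i <= mi al i)%N by rewrite leqNgt H.
have /eqP : (\sum_i mi al i == \sum_i g i)%N.
  by rewrite eqn_leq [X in _ && X]leq_sum // andbT gp; exact: mdeg_le.
move=> E i; apply/eqP; rewrite eqn_leq le andbT.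
move: E; rewrite (bigD1 i) //= [in RHS](bigD1 i) //= => E.
rewrite -(leq_add2r (\sum_(j | j != i) g j)) -E leq_add2l.
exact: leq_sum.
Qed.

(** Induction on [m], the number of derivatives left before order [p]. The remainder vanishes at
    [a], so each step back gains a factor $n|b-a|$. *)
Lemma taylor_rem_le a (d e : R) :
  (forall s x, size s = p -> `|x - a| <= d -> `|diter F s x - diter F s a| <= e) ->
  forall m g b, (\sum_j g j + m)%N = p -> `|b - a| <= d ->
    `|taylor_rem a g b| <= n%:R ^+ m * e * `|b - a| ^+ m.
Proof.
move=> He; elim=> [|m IH] g b.
  rewrite addn0 => gp bad; rewrite taylor_rem_top // !expr0 mul1r mulr1.
  by apply: He; rewrite ?size_mseq.
move=> gp bad; have gp' : (\sum_j g j < p)%N by rewrite -gp addnS ltnS leq_addr.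
rewrite -[taylor_rem a g b]subr0 -(taylor_rem_diag a (ltnW gp')).
have -> : n%:R ^+ m.+1 * e * `|b - a| ^+ m.+1 =
    n%:R * (n%:R ^+ m * e * `|b - a| ^+ m * `|b - a|) by rewrite !exprS; ring.
(* The radius is $|b-a|$ rather than [d], so that the bound keeps the power of $|b-a|$. *)
apply: increment_le => // [y i|y i ya]; have D := is_derive_taylor_rem a y i gp'.
  by case: D.
have e0 : 0 <= e.
  apply: le_trans (He (nseq p i) a _ _); rewrite ?size_nseq ?subrr ?normr0 //.
  exact: le_trans bad.
rewrite (@derive_val _ _ _ _ _ _ _ D); apply: le_trans (IH _ _ _ _) _.
- by rewrite sum_mincr addSnnS.
- exact: le_trans bad.
- apply: ler_wpM2l; first by rewrite mulr_ge0 // exprn_ge0.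
  by rewrite lerXn2r ?nnegrE.
Qed.

Lemma taylor_rem_small (c : pt) (e : R) : 0 < e ->
  exists2 d : R, 0 < d & forall a b, `|a - c| < d -> `|b - c| < d ->
    forall be : mindex n p,
      `|taylor_rem a (mi be) b| <= e * enorm (a - b) ^+ (p - mdeg be).
Proof.
(* The 2 pays for comparing values at [x] and [a] through [c]; $(n+1)^p$ dominates every $n^m$ with
   $m\le p$ and is positive even for $n=0$. *)
move=> e0; pose e' := e / (2 * n.+1%:R ^+ p).
have N0 : 0 < n.+1%:R ^+ p :> R by rewrite exprn_gt0.
have e'0 : 0 < e' by rewrite divr_gt0 // mulr_gt0.
have [d d0 Hd] : exists2 d, 0 < d &
    forall (s : p.-tuple 'I_n) x, `|x - c| < d -> `|diter F s c - diter F s x| < e'.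
  (* There are finitely many words of length [p], so one neighbourhood serves them all. *)
  have : \forall x \near c, forall s : p.-tuple 'I_n, `|diter F s c - diter F s x| < e'.
    pose Q (s : p.-tuple 'I_n) x := `|diter F s c - diter F s x| < e'.
    apply: (@filter_forall _ _ Q (nbhs c) _) => s.
    by have /cvgrPdist_lt/(_ _ e'0) := @CpF.2 s (eq_leq (size_tuple s)) c.
  move=> /nbhs_ballP[d /= d0 H]; exists d => // s x xcd.
  by apply: H; rewrite -ball_normE /= distrC.
(* Then $|b-a|\le 2d/3$, and any [x] within $2d/3$ of [a] is within [d] of [c]. *)
exists (d / 3); first by rewrite divr_gt0.
move=> a b ac bc be.
have He s x : size s = p -> `|x - a| <= 2 * (d / 3) ->
    `|diter F s x - diter F s a| <= 2 * e'.
  move=> /eqP sp xa; have xc : `|x - c| < d.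
    rewrite -(subrK a x) -addrA; apply: le_lt_trans (ler_normD _ _) _; lra.
  have acd : `|a - c| < d by lra.
  have := Hd (Tuple sp) _ xc; have := Hd (Tuple sp) _ acd => /= h1 h2.
  have := ler_distD (diter F s c) (diter F s x) (diter F s a).
  by rewrite [`|diter F s x - diter F s c|]distrC; lra.
have ba : `|b - a| <= 2 * (d / 3).
  rewrite -(subrK c b) -addrA; apply: le_trans (ler_normD _ _) _.
  by rewrite [`|c - a|]distrC; lra.
apply: le_trans (taylor_rem_le He _ ba) _; first exact: subnKC (mdeg_le be).
apply: ler_pM => //.
- by rewrite mulr_ge0 ?exprn_ge0 // mulr_ge0 // ltW.
- have -> : 2 * e' = e / n.+1%:R ^+ p.
    by rewrite /e'; move: (n.+1%:R ^+ p) N0 => N N0; field; rewrite gt_eqF.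
  rewrite mulrA ler_pdivrMr // [leLHS]mulrC ler_wpM2l ?(ltW e0) //.
  apply: (@le_trans _ _ (n.+1%:R ^+ (p - mdeg be))).
    by rewrite lerXn2r ?nnegrE // ler_nat.
  by rewrite ler_weXn2l ?ler1n // leq_subr.
- by rewrite distrC lerXn2r ?nnegrE ?sqrtr_ge0 // norm_le_enorm.
Qed.

End TaylorRemainder.

(** * Graphs of $\xi\mapsto\xi(T_aF)$ under the operations defining $\rho$ *)

Section GraphOfTaylor.
Variables (R : realType) (n p : nat).
Notation pt := 'rV[R]_n.
Notation rV := 'rV[R]_(rdim n p).
Variable F : pt -> R.
Hypothesis CpF : Cp p F.
Implicit Types (a b c : pt) (xi eta z : rV).

Lemma closure_ballP (T : pseudoMetricType R) (A : set T) x :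
  closure A x <-> forall e : R, 0 < e -> exists2 y, A y & ball x e y.
Proof.
split=> [cA e e0|H B /nbhs_ballP[e e0 eB]].
  by have [y [Ay xy]] := cA _ (nbhsx_ballx x e e0); exists y.
by have [y Ay xy] := H _ e0; exists y; split => //; exact: eB.
Qed.

Lemma continuous_wmono (g h : 'I_n -> nat) : continuous (fun a : pt => wmono g h (- a)).
Proof.
move=> a; rewrite /wmono.
have -> : (fun a : pt => \prod_i dpow (h i) (g i) ((- a) 0 i)) =
    \prod_i (fun a : pt => dpow (h i) (g i) (- a 0 i)).
  by apply/funext => x; rewrite fct_prodE; apply: eq_bigr => i _; rewrite mxE.
elim/big_ind : _ => [|f1 f2 c1 c2|i _].
- exact: (@cst_continuous _ _ (1 : R)).
- exact: continuousM.
apply: (@continuous_comp _ _ _ (fun a : pt => - a 0 i) (dpow (h i) (g i))).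
  by apply: (@continuousN _ _ _ (fun a : pt => a 0 i)); exact: coord_continuous.
exact: continuous_dpow.
Qed.

Lemma continuous_pairing_taylor :
  continuous (fun ax : pt * rV => pairing p ax.2 (taylor p F ax.1)).
Proof.
move=> ax.
have -> : (fun ax : pt * rV => pairing p ax.2 (taylor p F ax.1)) =
  \sum_(al : mindex n p) \sum_(be : mindex n p) (fun ax : pt * rV =>
    dmulti F al ax.1 * (wmono (mi be) (mi al) (- ax.1) / (mfact be)%:R * Defs.coord ax.2 be)).
  apply/funext => y; rewrite pairing_taylor fct_sumE; apply: eq_bigr => al _.
  rewrite fct_sumE mulr_sumr; apply: eq_bigr => be _.
  by rewrite coord_shiftmono.
have sumC (I : finType) (f : I -> pt * rV -> R) :
    (forall i, {for ax, continuous (f i)}) -> {for ax, continuous (\sum_i f i)}.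
  move=> cf; elim/big_ind : _ => [|f1 f2 c1 c2|i _].
  - exact: (@cst_continuous _ _ (0 : R)).
  - exact: continuousD.
  - exact: cf.
apply: (sumC) => al; apply: (sumC) => be; apply: continuousM.
  apply: (@continuous_comp _ _ _ fst (dmulti F al)); first exact: cvg_fst.
  apply: CpF.2; rewrite -[X in size X]/(mseq (mi al)) size_mseq; exact: mdeg_le.
apply: continuousM.
  apply: continuousM; last exact: cvg_cst.
  apply: (@continuous_comp _ _ _ fst (fun a => wmono _ _ (- a))); first exact: cvg_fst.
  exact: continuous_wmono.
apply: (@continuous_comp _ _ _ snd (fun x : rV => Defs.coord x be)); first exact: cvg_snd.
exact: coord_continuous.
Qed.

Lemma pairing_taylor_diff eta a b :
  pairing p eta (taylor p F b) - pairing p eta (taylor p F a) =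
  \sum_(be : mindex n p) taylor_rem p F a (mi be) b * xi_at eta be b.
Proof.
rewrite (pairing_taylor_rebase F eta a b) pairing_taylor -sumrB.
by apply: eq_bigr => be _; rewrite -mulrBl.
Qed.

(** The key estimate. Half of [e] pays for replacing $z(T_cF)$ by $(\xi+\eta)(T_aF)$, by joint
    continuity; the other half for replacing $\eta(T_aF)$ by $\eta(T_bF)$. *)
Lemma pairing_taylor_split c z (e : R) : 0 < e ->
  exists2 d, 0 < d & forall a b xi eta,
    ball c d a -> ball c d b -> ball z d (xi + eta) ->
    (forall al : mindex n p, enorm (a - b) ^+ (p - mdeg al) * `|xi_at eta al b| <= 1) ->
    `|pairing p z (taylor p F c) -
      (pairing p xi (taylor p F a) + pairing p eta (taylor p F b))| < e.
Proof.
move=> e0; have e2 : 0 < e / 2 by rewrite divr_gt0.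
have /cvgrPdist_lt/(_ _ e2)/nbhs_ballP[d1 /= d10 H1] := @continuous_pairing_taylor (c, z).
pose N := #|{: mindex n p}|.
(* Each of the [N] remainder terms will be at most [e']: the weight $|a-b|^{p-|\beta|}$ in its bound
   is absorbed by $\eta_\beta(b)$. *)
have [e' e'0 e'N] : exists2 e', 0 < e' & e' * N%:R < e / 2.
  exists (e / 2 / N.+1%:R); first by rewrite divr_gt0.
  by rewrite mulrAC ltr_pdivrMr // ltr_pM2l // ltr_nat ltnSn.
have [d2 d20 H2] := taylor_rem_small CpF c e'0.
exists (Num.min d1 d2); first by rewrite lt_min d10.
have m1 : Num.min d1 d2 <= d1 by rewrite ge_min lexx.
have m2 : Num.min d1 d2 <= d2 by rewrite ge_min lexx orbT.
move=> a b xi eta ca cb zxe weight.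
have {}H1 := H1 (a, xi + eta) (conj (le_ball m1 ca) (le_ball m1 zxe)).
have ad : `|a - c| < d2 by move/(le_ball m2) : ca; rewrite -ball_normE /= distrC.
have bd : `|b - c| < d2 by move/(le_ball m2) : cb; rewrite -ball_normE /= distrC.
have {}H2 := H2 _ _ ad bd.
have rest : `|pairing p eta (taylor p F b) - pairing p eta (taylor p F a)| < e / 2.
  rewrite pairing_taylor_diff; apply: le_lt_trans (ler_norm_sum _ _ _) _.
  apply: (@le_lt_trans _ _ (\sum_(be : mindex n p) e')).
    apply: ler_sum => be _; rewrite normrM.
    apply: le_trans (ler_wpM2r (normr_ge0 _) (H2 be)) _.
    by rewrite -mulrA ler_piMr // ltW.
  by rewrite sumr_const -[X in X < _]mulr_natr.
move: H1 rest; rewrite /= pairingDl.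
move: (pairing p z _) (pairing p xi _) (pairing p eta (taylor p F a))
  (pairing p eta (taylor p F b)) => A B C D.
rewrite !ltr_norml => /andP[? ?] /andP[? ?]; apply/andP; split; lra.
Qed.

Variable X : set pt.
Implicit Types (E : set (pt * rV)).

Definition taylor_graph E : set (pt * (rV * R)) :=
  [set u | E (u.1, u.2.1) /\ u.2.2 = pairing p u.2.1 (taylor p F u.1)].

Lemma Phiprime_taylor_graph E : Phiprime X (taylor_graph E) = taylor_graph (Eprime X E).
Proof.
apply/seteqP; split => -[c [z lam]] /=.
  move=> [Xc /closure_ballP H]; split.
    split => //; apply/closure_ballP => e e0.
    have [[[a b] [y mu]] /= [Xa [Xb [[xi l1] [[eta l2]]]]]] := H _ e0.
    move=> [[/= Ea _] [[/= Eb _] [[-> _] w]]] [[ca cb] [cy _]].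
    exists (a, b, xi + eta) => //=; split => //; split => //.
    by exists xi, eta.
  (* The limit value [lam] equals $z(T_cF)$, since they differ by less than any [e]: half from the
     closure, half from the key estimate. *)
  apply/eqP; rewrite -subr_eq0 -normr_le0; apply/ler_addgt0Pr => e e0; rewrite add0r.
  have e2 : 0 < e / 2 by rewrite divr_gt0.
  have [d d0 K] := pairing_taylor_split c z e2.
  have m0 : 0 < Num.min d (e / 2) by rewrite lt_min d0.
  have m1 : Num.min d (e / 2) <= d by rewrite ge_min lexx.
  have m2 : Num.min d (e / 2) <= e / 2 by rewrite ge_min lexx orbT.
  have [[[a b] [y mu]] /= [Xa [Xb [[xi l1] [[eta l2]]]]]] := H _ m0.
  move=> [[/= Ea l1E] [[/= Eb l2E] [[yE muE] w]]] [[/= ca cb] [/= cy cmu]].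
  rewrite yE in cy; have := K _ _ _ _ (le_ball m1 ca) (le_ball m1 cb) (le_ball m1 cy) w.
  rewrite -l1E -l2E -muE => k1; move: (le_ball m2 cmu).
  rewrite -ball_normE /= => k2.
  move: k1 k2; rewrite !ltr_norml ler_norml => /andP[? ?] /andP[? ?].
  by apply/andP; split; lra.
(* Conversely, nearby points of [DeltaE] lift to [DeltaPhi] with last component
   $\xi(T_aF)+\eta(T_bF)$, close to $z(T_cF)$. *)
move=> [[/= Xc /closure_ballP H] ->]; split => //; apply/closure_ballP => e e0.
have [d d0 K] := pairing_taylor_split c z e0.
have m0 : 0 < Num.min d e by rewrite lt_min d0.
have m1 : Num.min d e <= d by rewrite ge_min lexx.
have m2 : Num.min d e <= e by rewrite ge_min lexx orbT.
have [[[a b] y] /= [Xa [Xb [xi [eta [Ea [Eb [-> w]]]]]]]] := H _ m0.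
move=> [[/= ca cb] /= cy].
exists (a, b, (xi + eta, pairing p xi (taylor p F a) + pairing p eta (taylor p F b))).
  do 2!split => //.
  by exists (xi, pairing p xi (taylor p F a)), (eta, pairing p eta (taylor p F b)).
split; first by split; [exact: (le_ball m2 ca)|exact: (le_ball m2 cb)].
split; first exact: (le_ball m2 cy).
rewrite -ball_normE /=.
exact: K (le_ball m1 ca) (le_ball m1 cb) (le_ball m1 cy) w.
Qed.

Lemma rhoPhi_taylor_graph E : rhoPhi X (taylor_graph E) = taylor_graph (rhoE X E).
Proof.
have sum1 k (w : 'I_k -> rV * R) : (\sum_i w i).1 = \sum_i (w i).1.
  by apply: (big_morph fst).
have sum2 k (w : 'I_k -> rV * R) : (\sum_i w i).2 = \sum_i (w i).2.
  by apply: (big_morph snd).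
apply/seteqP; split => -[a [xi lam]]; rewrite /rhoPhi Phiprime_taylor_graph /=.
  move=> [Xa [k [c [w [wE xlE]]]]].
  have -> : xi = \sum_i c i *: (w i).1 by rewrite -[xi]/((xi, lam).1) xlE sum1.
  have -> : lam = \sum_i c i * (w i).2 by rewrite -[lam]/((xi, lam).2) xlE sum2.
  split.
    by split => //; exists k, c, (fun i => (w i).1); split => // i; case: (wE i).
  by rewrite pairing_suml; apply: eq_bigr => i _; case: (wE i) => _ /= ->.
move=> [[/= Xa [k [c [w [wE ->]]]]] ->]; split => //.
exists k, c, (fun i => (w i, pairing p (w i) (taylor p F a))); split => [i|].
  by split; [exact: wE|].
by rewrite [RHS]surjective_pairing sum1 sum2 pairing_suml.
Qed.

(** This is the vanishing at [a] of the remainder of order $g=0$, whose word of derivatives is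
    empty. *)
Lemma pairing_dirac_taylor a : pairing p (dirac_pt p a) (taylor p F a) = F a.
Proof.
rewrite pairing_taylor; under eq_bigr do rewrite xi_at_dirac.
have s0 : (\sum_(j < n) 0 <= p)%N by rewrite big1.
have := taylor_rem_diag F a s0; rewrite /taylor_rem => /subr0_eq <-.
by have /size0nil -> : size (mseq (fun _ : 'I_n => 0%N)) = 0%N by rewrite size_mseq big1.
Qed.

Lemma Phi0_taylor_graph f : (forall x, X x -> F x = f x) ->
  @Phi0 R n p X f = taylor_graph (@E0 R n p X).
Proof.
move=> Ff; apply/seteqP; split => -[a [xi lam]] /=.
  move=> [Xa [l [-> ->]]]; split; first by split => //; exists l.
  by rewrite pairingZl pairing_dirac_taylor Ff.
move=> [[/= Xa [l ->]] ->]; split => //; exists l.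
by rewrite pairingZl pairing_dirac_taylor Ff.
Qed.

Lemma iter_rhoPhi_taylor_graph k f : (forall x, X x -> F x = f x) ->
  iter k (rhoPhi X) (@Phi0 R n p X f) = taylor_graph (iter k (rhoE X) (@E0 R n p X)).
Proof.
move=> Ff; elim: k => [|k IH]; first exact: Phi0_taylor_graph.
by rewrite !iterS IH rhoPhi_taylor_graph.
Qed.

Lemma iter_rhoE_base k a : (forall xi, iter k (rhoE X) (@E0 R n p X) (a, xi) -> X a) /\
  (X a -> iter k (rhoE X) (@E0 R n p X) (a, 0)).
Proof.
case: k => [|k]; split => [xi []|Xa] //; split => //=.
  by exists 0; rewrite scale0r.
by exists 0%N, (fun=> 0), (fun=> 0); rewrite big_ord0; split => // -[].
Qed.

(* This monotonicity is all that is needed to compare the 2r steps of tau with the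
   2(r+1) steps of nabla: the stabilisation of the iterates plays no role. *)
Lemma iter_rhoE_sub k : iter k (rhoE X) (@E0 R n p X) `<=` iter k.+1 (rhoE X) (@E0 R n p X).
Proof.
move=> [a xi] Ea; have [/(_ _ Ea) Xa /(_ Xa) E0a] := iter_rhoE_base k a.
split => //; exists 1%N, (fun=> 1), (fun=> xi); split; last first.
  by rewrite big_ord1 scale1r.
move=> _; split => //=; apply: subset_closure => /=; do 2!split => //.
(* With $b=a$ and $\eta=0$ the bounds are trivial, so $\xi$ itself lies in $E'_a$. *)
exists xi, 0; rewrite addr0; do 3!split => //; move=> al.
rewrite /xi_at /pairing big1 ?normr0 ?mulr0 // => be _.
by rewrite /Defs.coord [X in _ * X]mxE mulr0.
Qed.

End GraphOfTaylor.

(** * Existence, uniqueness and value of $\nabla^pf(\xi)$ *)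

Theorem theorem1p1 (R : realType) (n p : nat) (X : set 'rV[R]_n)
  (f : 'rV[R]_n -> R) (F : 'rV[R]_n -> R) :
  closed X ->
  Cp p F ->
  (forall x, X x -> F x = f x) ->
  (forall (a : 'rV[R]_n) (xi : 'rV[R]_(rdim n p)),
     X a -> tau p X (a, xi) ->
     exists! lam : R, nabla p X f (a, (xi, lam))) /\
  (forall (a : 'rV[R]_n) (xi : 'rV[R]_(rdim n p)),
     X a -> tau p X (a, xi) ->
     nabla p X f (a, (xi, pairing p xi (taylor p F a)))).
Proof.
move=> _ CpF Ff; rewrite /nabla (iter_rhoPhi_taylor_graph CpF _ Ff).
have sub a xi : tau p X (a, xi) -> iter (2 * (rdim n p).+1) (rhoE X) (@E0 R n p X) (a, xi).
  (* Since $2(r+1)=2r+2$, two inclusions suffice. *)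
  by rewrite mulnS => /iter_rhoE_sub/iter_rhoE_sub.
split=> a xi Xa /sub Ea; last by split.
by exists (pairing p xi (taylor p F a)); split => [|lam [_ /= ->]].
Qed.
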